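(* Let $E$ be a Gysin functor on a finitary lextensive category $\mathcal{C}$, and let $\mathcal{C}_E$ be its category of correspondences. Every map in $\mathcal{C}_E(X,Y)$ can be represented by a pair consisting of a span $[Y\xleftarrow{f}Z\xrightarrow{g}X]$ in $\mathcal{C}$ and an element $a\in E(Z)$, where this pair represents $Rf\circ Da\circ Ig$. If a map in $\mathcal{C}_E(U,X)$ is represented by the span $[X\xleftarrow{f'}Z'\xrightarrow{g'}U]$ and $a'\in E(Z')$, then the composite of the two maps (in $\mathcal{C}_E(U,Y)$) is represented by the span $[Y\xleftarrow{fs}P\xrightarrow{g't}U]$ and the element $(s^*a)(t^*a')\in E(P)$, where $P$, with maps $s\colon P\to Z$ and $t\colon P\to Z'$, is the pullback of $Z\xrightarrow{g}X\xleftarrow{f'}Z'$. That is, $$(Rf\circ Da\circ Ig)\circ(Rf'\circ Da'\circ Ig')=R(fs)\circ D\big((s^*a)(t^*a')\big)\circ I(g't).$$ Moreover, for every $f\colon Z\to Y$ in $\mathcal{C}$ and $a\in E(Z)$, the pair $\big([Y\xleftarrow{f}Z\xrightarrow{f}Y],\ a\in E(Z)\big)$ and the pair $\big([Y\xleftarrow{\mathrm{id}}Y\xrightarrow{\mathrm{id}}Y],\ f_!(a)\in E(Y)\big)$ represent the same map in $\mathcal{C}_E(Y,Y)$.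
   Context: Finitary lextensive category: a category $\mathcal{C}$ with finite limits and finite coproducts such that (i) for all maps $A\to X$, $P_1\to X$, $P_2\to X$ the natural map $(A\times_X P_1)\amalg (A\times_X P_2)\to A\times_X(P_1\amalg P_2)$ is an isomorphism; (ii) for all objects $A,B$, with coproduct inclusions $i_0\colon A\to A\amalg B$, $i_1\colon B\to A\amalg B$, one has that $A$ (with identity maps) is the pullback of $A\xrightarrow{i_0}A\amalg B\xleftarrow{i_0}A$, $B$ (with identity maps) is the pullback of $B\xrightarrow{i_1}A\amalg B\xleftarrow{i_1}B$, and $\emptyset$ is the pullback of $A\xrightarrow{i_0}A\amalg B\xleftarrow{i_1}B$. Gysin functor on $\mathcal{C}$: a contravariant functor $E$ from $\mathcal{C}$ to commutative rings together with a covariant functor $\tilde E$ from $\mathcal{C}$ to abelian groups with $\tilde E(X)=E(X)$ (as abelian groups) for all $X$. For $f\colon X\to Y$ write $f^*=E(f)\colon E(Y)\to E(X)$ and $f_!=\tilde E(f)\colon E(X)\to E(Y)$; for $a\in E(X)$, $b\in E(Y)$ write $a\otimes b=(\pi_X)^*(a)\cdot(\pi_Y)^*(b)\in E(X\times Y)$, with $\pi_X,\pi_Y$ the projections of $X\times Y$. Axioms: (1) $E(\emptyset)=0$; (2) $(i_X^*,i_Y^* )\colon E(X\amalg Y)\to E(X)\times E(Y)$ is an isomorphism of rings; (3) $(f\times g)_!(a\otimes b)=f_!(a)\otimes g_!(b)$ for all $f\colon X\to X'$, $g\colon Y\to Y'$, $a\in E(X)$, $b\in E(Y)$; (4) for every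 pullback square with $f\colon A\to B$, $p\colon A\to C$, $q\colon B\to D$, $g\colon C\to D$ ($qf=gp$), one has $f_!p^*=q^*g_!$. The category $\mathcal{C}_E$ of $E$-correspondences: same objects as $\mathcal{C}$; $\mathcal{C}_E(A,B)=E(B\times A)$ as abelian group; the composite of $\beta\in\mathcal{C}_E(A,B)$ and $\alpha\in\mathcal{C}_E(B,C)$ is $\alpha\circ\beta=(\pi_{13})_!\big(\pi_{12}^*(\alpha)\cdot\pi_{23}^*(\beta)\big)$, with $\pi_{12},\pi_{13},\pi_{23}$ the projections from $C\times B\times A$ to $C\times B$, $C\times A$, $B\times A$; the identity of $A$ is $i_A=(\Delta_A)_!(1)\in E(A\times A)$, with $\Delta_A\colon A\to A\times A$ the diagonal. For $f\colon A\to B$ in $\mathcal{C}$: $Rf=(\mathrm{id}_B\times f)^*(i_B)\in E(B\times A)=\mathcal{C}_E(A,B)$ and $If=(f\times\mathrm{id}_B)^*(i_B)\in E(A\times B)=\mathcal{C}_E(B,A)$. For $a\in E(X)$: $Da=(\Delta_X)_!(a)\in E(X\times X)=\mathcal{C}_E(X,X)$. *)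

(* Defs.v *)
From HB Require Import structures.
From mathcomp Require Import all_boot all_algebra.
Set Implicit Arguments.
Unset Strict Implicit.
Unset Printing Implicit Defensive.
Import GRing.Theory.
Local Open Scope ring_scope.

Declare Scope cat_scope.
Delimit Scope cat_scope with cat.

Record category := Category {
  obj :> Type;
  mor : obj -> obj -> Type;
  idm : forall A, mor A A;
  comp : forall A B C, mor B C -> mor A B -> mor A C;
  comp1m : forall A B (f : mor A B), comp (idm B) f = f;
  compm1 : forall A B (f : mor A B), comp f (idm A) = f;
  compA : forall A B C D (h : mor C D) (g : mor B C) (f : mor A B),
    comp h (comp g f) = comp (comp h g) f
}.
Arguments mor {c} A B.
Arguments idm {c} A.
Arguments comp {c A B C} g f.

Notation "g \o f" := (comp g f) : cat_scope.
Local Open Scope cat_scope.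

Definition is_iso (C : category) (A B : C) (f : mor A B) : Prop :=
  exists g : mor B A, g \o f = idm A /\ f \o g = idm B.

Record functor (J C : category) := Functor {
  fobj :> J -> C;
  fmap : forall i j, mor i j -> mor (fobj i) (fobj j);
  fmap1 : forall i, fmap (idm i) = idm (fobj i);
  fmapM : forall i j k (v : mor j k) (u : mor i j),
    fmap (v \o u) = fmap v \o fmap u
}.

Definition is_cone (J C : category) (F : functor J C) (L : C)
    (p : forall i, mor L (F i)) : Prop :=
  forall i j (u : mor i j), fmap F u \o p i = p j.

Definition is_limit (J C : category) (F : functor J C) (L : C)
    (p : forall i, mor L (F i)) : Prop :=
  is_cone p /\
  forall (W : C) (q : forall i, mor W (F i)), is_cone q ->
    exists! m : mor W L, forall i, p i \o m = q i.

Definition finite_type (T : Type) : Prop :=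
  exists (n : nat) (e : 'I_n -> T), forall x, exists i, e i = x.

Definition finite_category (J : category) : Prop :=
  finite_type J /\ forall i j : J, finite_type (mor i j).

Definition has_finite_limits (C : category) : Prop :=
  forall (J : category) (F : functor J C), finite_category J ->
    exists (L : C) (p : forall i, mor L (F i)), is_limit p.

Definition has_finite_coproducts (C : category) : Prop :=
  forall (n : nat) (X : 'I_n -> C),
    exists (S : C) (inj : forall i, mor (X i) S),
      forall (W : C) (q : forall i, mor (X i) W),
        exists! m : mor S W, forall i, m \o inj i = q i.

Definition is_initial (C : category) (Z : C) : Prop :=
  forall W : C, exists! m : mor Z W, True.

Definition is_coproduct (C : category) (A B S : C)
    (i0 : mor A S) (i1 : mor B S) : Prop :=
  forall (W : C) (u : mor A W) (v : mor B W),
    exists! m : mor S W, m \o i0 = u /\ m \o i1 = v.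

(* [is_pullback f p q g]: the square  q \o f = g \o p  is cartesian, where
   f : A -> B, p : A -> C, q : B -> D, g : C -> D. *)
Definition is_pullback (K : category) (A B C D : K)
    (f : mor A B) (p : mor A C) (q : mor B D) (g : mor C D) : Prop :=
  q \o f = g \o p /\
  forall (W : K) (u : mor W B) (v : mor W C), q \o u = g \o v ->
    exists! m : mor W A, f \o m = u /\ p \o m = v.

(* S = P1 + P2 over X, Qi = A x_X Pi, Q = A x_X S, T = Q1 + Q2, all of them
   arbitrary (co)limits; the equations on m say that it is the natural map
   T -> Q (which exists and is unique). *)
Definition pullback_distributes (C : category) : Prop :=
  forall (X A P1 P2 : C) (f : mor A X) (p1 : mor P1 X) (p2 : mor P2 X)
    (S : C) (j1 : mor P1 S) (j2 : mor P2 S) (h : mor S X)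
    (Q1 : C) (a1 : mor Q1 A) (b1 : mor Q1 P1)
    (Q2 : C) (a2 : mor Q2 A) (b2 : mor Q2 P2)
    (Q : C) (a : mor Q A) (b : mor Q S)
    (T : C) (k1 : mor Q1 T) (k2 : mor Q2 T) (m : mor T Q),
  is_coproduct j1 j2 -> h \o j1 = p1 -> h \o j2 = p2 ->
  is_pullback a1 b1 f p1 -> is_pullback a2 b2 f p2 -> is_pullback a b f h ->
  is_coproduct k1 k2 ->
  a \o (m \o k1) = a1 -> b \o (m \o k1) = j1 \o b1 ->
  a \o (m \o k2) = a2 -> b \o (m \o k2) = j2 \o b2 ->
  is_iso m.

Definition coproducts_disjoint (C : category) : Prop :=
  forall (A B S : C) (i0 : mor A S) (i1 : mor B S), is_coproduct i0 i1 ->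
  [/\ is_pullback (idm A) (idm A) i0 i0,
      is_pullback (idm B) (idm B) i1 i1 &
      forall (Z : C) (z0 : mor Z A) (z1 : mor Z B), is_initial Z ->
        is_pullback z0 z1 i0 i1].

Definition finitary_lextensive (C : category) : Prop :=
  [/\ has_finite_limits C, has_finite_coproducts C,
      pullback_distributes C & coproducts_disjoint C].

(* A choice of binary products, on which the hom-groups E(B x A) depend. *)
Record binary_products (C : category) := BinaryProducts {
  prodo : C -> C -> C;
  pr1 : forall A B, mor (prodo A B) A;
  pr2 : forall A B, mor (prodo A B) B;
  pair : forall W A B, mor W A -> mor W B -> mor W (prodo A B);
  pr1_pair : forall W A B (u : mor W A) (v : mor W B), pr1 A B \o pair u v = u;
  pr2_pair : forall W A B (u : mor W A) (v : mor W B), pr2 A B \o pair u v = v;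
  pair_eta : forall W A B (m : mor W (prodo A B)),
    pair (pr1 A B \o m) (pr2 A B \o m) = m
}.

Section ProductMaps.
Variables (C : category) (P : binary_products C).

Definition prodm (A A' B B' : C) (f : mor A A') (g : mor B B') :
    mor (prodo P A B) (prodo P A' B') :=
  pair P (f \o pr1 P A B) (g \o pr2 P A B).

Definition diag (A : C) : mor A (prodo P A A) := pair P (idm A) (idm A).

(* The projections of the triple product A x B x D := (A x B) x D. *)
Definition pr12 (A B D : C) : mor (prodo P (prodo P A B) D) (prodo P A B) :=
  pr1 P (prodo P A B) D.
Definition pr13 (A B D : C) : mor (prodo P (prodo P A B) D) (prodo P A D) :=
  prodm (pr1 P A B) (idm D).
Definition pr23 (A B D : C) : mor (prodo P (prodo P A B) D) (prodo P B D) :=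
  prodm (pr2 P A B) (idm D).
End ProductMaps.
Arguments diag {C} P A.
Arguments pr12 {C} P A B D.
Arguments pr13 {C} P A B D.
Arguments pr23 {C} P A B D.

(* Rings may be trivial ([comPzRingType]), as E(initial object) = 0. *)
Record gysin_data (C : category) := GysinData {
  gring :> C -> comPzRingType;
  pull : forall X Y : C, mor X Y -> {rmorphism gring Y -> gring X};
  push : forall X Y : C, mor X Y -> {additive gring X -> gring Y};
  pull1 : forall (X : C) (x : gring X), pull (idm X) x = x;
  pullM : forall (X Y Z : C) (g : mor Y Z) (f : mor X Y) (z : gring Z),
    pull (g \o f) z = pull f (pull g z);
  push1 : forall (X : C) (x : gring X), push (idm X) x = x;
  pushM : forall (X Y Z : C) (g : mor Y Z) (f : mor X Y) (x : gring X),
    push (g \o f) x = push g (push f x)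
}.

Definition tens (C : category) (P : binary_products C) (E : gysin_data C)
    (X Y : C) (a : E X) (b : E Y) : E (prodo P X Y) :=
  pull E (pr1 P X Y) a * pull E (pr2 P X Y) b.

Record gysin_functor (C : category) (P : binary_products C) := GysinFunctor {
  gdata :> gysin_data C;
  gysin_initial : forall Z : C, is_initial Z -> forall x : gdata Z, x = 0;
  (* The map is a ring morphism since its components are. *)
  gysin_coproduct : forall (X Y S : C) (iX : mor X S) (iY : mor Y S),
    is_coproduct iX iY ->
    bijective (fun x : gdata S => (pull gdata iX x, pull gdata iY x));
  gysin_tens : forall (X X' Y Y' : C) (f : mor X X') (g : mor Y Y')
      (a : gdata X) (b : gdata Y),
    push gdata (prodm P f g) (tens P a b) =
      tens P (push gdata f a) (push gdata g b);
  gysin_base_change : forall (A B K D : C)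
      (f : mor A B) (p : mor A K) (q : mor B D) (g : mor K D),
    is_pullback f p q g ->
    forall x : gdata K, push gdata f (pull gdata p x) = pull gdata q (push gdata g x)
}.

Section Correspondences.
Variables (C : category) (P : binary_products C) (E : gysin_functor P).

Local Notation "A ** B" := (prodo P A B) (at level 40, left associativity).

Definition corr (A B : C) : Type := E (B ** A).

Definition corr_id (A : C) : corr A A := push E (diag P A) 1.

Definition corr_comp (A B D : C) (alpha : corr B D) (beta : corr A B) :
    corr A D :=
  push E (pr13 P D B A)
    (pull E (pr12 P D B A) alpha * pull E (pr23 P D B A) beta).

Lemma prod_ext (W A B : C) (u v : mor W (A ** B)) :
  pr1 P A B \o u = pr1 P A B \o v -> pr2 P A B \o u = pr2 P A B \o v -> u = v.
Proof. by move=> h1 h2; rewrite -(pair_eta u) h1 h2 pair_eta. Qed.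

Lemma comp_pair (V W A B : C) (u : mor W A) (v : mor W B) (m : mor V W) :
  pair P u v \o m = pair P (u \o m) (v \o m).
Proof. by apply: prod_ext; rewrite compA ?pr1_pair ?pr2_pair. Qed.

Lemma pr1_pairA (V W A B : C) (u : mor W A) (v : mor W B) (m : mor V W) :
  pr1 P A B \o (pair P u v \o m) = u \o m.
Proof. by rewrite compA pr1_pair. Qed.

Lemma pr2_pairA (V W A B : C) (u : mor W A) (v : mor W B) (m : mor V W) :
  pr2 P A B \o (pair P u v \o m) = v \o m.
Proof. by rewrite compA pr2_pair. Qed.

Let simpp := (comp_pair, pr1_pair, pr2_pair, pr1_pairA, pr2_pairA,
              comp1m, compm1).
Let unfp := (=^~ compA, simpp).

Lemma projection_formula (X Y : C) (f : mor X Y) (a : E X) (b : E Y) :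
  push E f (a * pull E f b) = push E f a * b.
Proof.
have pb : is_pullback f (pair P (idm X) f) (diag P Y) (prodm P f (idm Y)).
  split; first by rewrite /diag /prodm ?unfp.
  move=> W u v /[dup] /(congr1 (comp (pr1 P _ _))) + /(congr1 (comp (pr2 P _ _))).
  rewrite /diag /prodm ?unfp => e1 e2.
  exists (pr1 P _ _ \o v); split.
    by split; [rewrite -e1 | apply: prod_ext; rewrite ?unfp // -e1 e2].
  by move=> m [_ <-]; rewrite ?unfp.
have := gysin_base_change pb (tens P a b).
rewrite gysin_tens /tens !rmorphM /= -!pullM ?unfp /diag ?unfp.
by rewrite !pull1 push1.
Qed.

Lemma corr_comp1m (A B : C) (beta : corr A B) :
  corr_comp (corr_id B) beta = beta.
Proof.
pose d := prodm P (diag P B) (idm A).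
have pb : is_pullback d (pr1 P B A) (pr12 P B B A) (diag P B).
  split; first by rewrite /d /pr12 /prodm ?unfp.
  move=> W u v; rewrite /pr12 /d => e.
  have e1 := congr1 (comp (pr1 P _ _)) e; have e2 := congr1 (comp (pr2 P _ _)) e.
  move: e1 e2; rewrite /diag /prodm ?unfp => e1 e2.
  exists (pair P v (pr2 P _ _ \o u)); split.
    split; last by rewrite ?unfp.
    by apply: prod_ext; rewrite ?unfp //; apply: prod_ext; rewrite ?unfp.
  by move=> m [<- <-]; apply: prod_ext; rewrite ?unfp.
rewrite /corr_comp /corr_id -(gysin_base_change pb) rmorph1.
rewrite -projection_formula mul1r -pullM -pushM.
have -> : pr23 P B B A \o d = idm _.
  by apply: prod_ext; rewrite /pr23 /d /prodm /diag ?unfp.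
have -> : pr13 P B B A \o d = idm _.
  by apply: prod_ext; rewrite /pr13 /d /prodm /diag ?unfp.
by rewrite pull1 push1.
Qed.

Lemma corr_compm1 (A B : C) (alpha : corr A B) :
  corr_comp alpha (corr_id A) = alpha.
Proof.
pose d := pair P (idm (B ** A)) (pr2 P B A).
have pb : is_pullback d (pr2 P B A) (pr23 P B A A) (diag P A).
  split; first by rewrite /d /pr23 /prodm /diag ?unfp.
  move=> W u v; rewrite /pr23 /d => e.
  have e1 := congr1 (comp (pr1 P _ _)) e; have e2 := congr1 (comp (pr2 P _ _)) e.
  move: e1 e2; rewrite /diag /prodm ?unfp => e1 e2.
  exists (pr1 P _ _ \o u); split.
    split; last by [].
    by apply: prod_ext; rewrite ?unfp // e1 e2.
  by move=> m [<- _]; rewrite ?unfp.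
rewrite /corr_comp /corr_id -(gysin_base_change pb) rmorph1.
rewrite mulrC -projection_formula mul1r -pullM -pushM.
have -> : pr12 P B A A \o d = idm _ by rewrite /pr12 /d ?unfp.
have -> : pr13 P B A A \o d = idm _.
  by apply: prod_ext; rewrite /pr13 /d /prodm /diag ?unfp.
by rewrite pull1 push1.
Qed.

Lemma corr_compA (A B D F : C) (alpha : corr D F) (beta : corr B D)
    (gamma : corr A B) :
  corr_comp alpha (corr_comp beta gamma) =
  corr_comp (corr_comp alpha beta) gamma.
Proof.
pose V := F ** D ** B ** A.
pose l : mor V (F ** D ** A) := prodm P (pr1 P (F ** D) B) (idm A).
pose l' : mor V (D ** B ** A) :=
  prodm P (prodm P (pr2 P F D) (idm B)) (idm A).
pose r : mor V (F ** B ** A) := prodm P (pr13 P F D B) (idm A).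
have pbl : is_pullback l l' (pr23 P F D A) (pr13 P D B A).
  split; first by rewrite /l /l' /pr13 /pr23 /prodm ?unfp.
  move=> W u v e.
  have e1 := congr1 (comp (pr1 P _ _)) e; have e2 := congr1 (comp (pr2 P _ _)) e.
  move: e1 e2; rewrite /pr13 /pr23 /prodm ?unfp => e1 e2.
  exists (pair P (pair P (pr1 P _ _ \o u)
     (pr2 P _ _ \o (pr1 P _ _ \o v))) (pr2 P _ _ \o v)); split.
    rewrite /l /l' /prodm ?unfp; split; apply: prod_ext; rewrite ?unfp //.
    by apply: prod_ext; rewrite ?unfp.
  move=> m [<- <-]; rewrite /l /l' /prodm; apply: prod_ext; rewrite ?unfp //.
  by apply: prod_ext; rewrite ?unfp.
have pbr : is_pullback r (pr1 P (F ** D ** B) A) (pr12 P F B A) (pr13 P F D B).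
  split; first by rewrite /r /pr12 /prodm ?unfp.
  move=> W u v; rewrite /pr12 => e.
  exists (pair P v (pr2 P _ _ \o u)); split.
    split; last by rewrite ?unfp.
    apply: prod_ext; rewrite /r /prodm ?unfp //.
    by rewrite e /pr13 /prodm ?unfp.
  by move=> m [<- <-]; rewrite /r /prodm; apply: prod_ext; rewrite ?unfp.
rewrite /corr_comp -(gysin_base_change pbl) -(gysin_base_change pbr).
rewrite mulrC -!projection_formula -!pushM !rmorphM -!pullM.
have -> : pr13 P F D A \o l = pr13 P F B A \o r.
  by apply: prod_ext; rewrite /pr13 /l /r /pr13 /prodm ?unfp.
congr (push E _ _).
rewrite mulrC mulrA; congr (_ * _); last first.
  congr (pull E _ _); rewrite /pr23 /l' /r /pr13 /prodm.
  by apply: prod_ext; rewrite ?unfp.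
congr (_ * _).
  by congr (pull E _ _); rewrite /pr12 /l /prodm ?unfp.
by congr (pull E _ _); rewrite /pr12 /pr23 /l' /prodm ?unfp.
Qed.

Definition corr_cat : category := {|
  obj := C;
  mor := corr;
  idm := corr_id;
  comp := corr_comp;
  comp1m := corr_comp1m;
  compm1 := corr_compm1;
  compA := corr_compA
|}.

Definition corrR (A B : C) (f : mor A B) : @mor corr_cat A B :=
  pull E (prodm P (idm B) f) (@idm corr_cat B).

Definition corrI (A B : C) (f : mor A B) : @mor corr_cat B A :=
  pull E (prodm P f (idm B)) (@idm corr_cat B).

Definition corrD (X : C) (a : E X) : @mor corr_cat X X := push E (diag P X) a.
End Correspondences.

(* Main.v *)
Require Import Defs.
From HB Require Import structures.
From mathcomp Require Import all_boot all_algebra.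
Set Implicit Arguments.
Unset Strict Implicit.
Unset Printing Implicit Defensive.
Import GRing.Theory.
Local Open Scope ring_scope.
Local Open Scope cat_scope.

(** A span [Y <-f- Z -g-> X] with a weight [a] on its apex has an obvious
    correspondence attached to it: the pushforward of [a] along
    [pair f g : Z -> Y x X].  Everything follows from the claim that this
    class, [span_class f g a], is the morphism [Rf o Da o Ig]
    ([corr_span_class]).  Indeed:
    - every class on [Y x X] is the pushforward of itself along the identity,
      whose components are the two projections;
    - the pushforward along [pair f f], which is the diagonal after [f], is
      the pushforward along the diagonal of [f_! a];
    - span classes compose by pullback of spans ([span_class_comp]), by two
      base changes and two applications of the projection formula.

    The claim itself is a consequence of the composition rule: [Rf], [Da] and
    [Ig] are the span classes of [(f, id, 1)], [(id, id, a)] and [(id, g, 1)],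
    and these three spans compose along identity squares. *)

Section SpanClasses.
Variables (C : category) (P : binary_products C) (E : gysin_functor P).

Local Notation "A ** B" := (prodo P A B) (at level 40, left associativity).

Let simp_prod := (=^~ Defs.compA, (comp_pair, pr1_pair, pr2_pair,
  @pr1_pairA C P, @pr2_pairA C P, comp1m, compm1)).

Lemma prod_eqP (W A B : C) (u v : mor W (A ** B)) :
  u = v -> pr1 P A B \o u = pr1 P A B \o v /\ pr2 P A B \o u = pr2 P A B \o v.
Proof. by move->. Qed.

Lemma pullback_idm (A : C) : is_pullback (idm A) (idm A) (idm A) (idm A).
Proof.
split=> // W u v; rewrite !comp1m => <-; exists u.
by split=> [|m [<- _]]; rewrite !comp1m.
Qed.

Definition span_class (X Y Z : C) (f : mor Z Y) (g : mor Z X) (a : E Z) :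
    @mor (corr_cat E) X Y :=
  push E (pair P f g) a.

Lemma corrD_span_class (X : C) (a : E X) :
  corrD a = span_class (idm X) (idm X) a.
Proof. by []. Qed.

(** The graph of [f] is the base change of the diagonal of [B] along
    [id x f]. *)
Lemma corrR_span_class (A B : C) (f : mor A B) :
  corrR E f = span_class f (idm A) 1.
Proof.
have pb : is_pullback (pair P f (idm A)) f (prodm P (idm B) f) (diag P B).
  split; first by rewrite /prodm /diag ?simp_prod.
  move=> W u v /prod_eqP; rewrite /prodm /diag ?simp_prod => -[e1 e2].
  exists (pr2 P _ _ \o u); split.
    by split=> //; apply: prod_ext; rewrite ?simp_prod // e1 e2.
  by move=> m [<- _]; rewrite ?simp_prod.
by rewrite /corrR /= /corr_id -(gysin_base_change pb) rmorph1.
Qed.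

Lemma corrI_span_class (A B : C) (f : mor A B) :
  corrI E f = span_class (idm A) f 1.
Proof.
have pb : is_pullback (pair P (idm A) f) f (prodm P f (idm B)) (diag P B).
  split; first by rewrite /prodm /diag ?simp_prod.
  move=> W u v /prod_eqP; rewrite /prodm /diag ?simp_prod => -[e1 e2].
  exists (pr1 P _ _ \o u); split.
    by split=> //; apply: prod_ext; rewrite ?simp_prod // e1 e2.
  by move=> m [<- _]; rewrite ?simp_prod.
by rewrite /corrI /= /corr_id -(gysin_base_change pb) rmorph1.
Qed.

(** The product over [Y x X x U] that defines the composite is supported on
    [Z x U] because of its first factor; there the second factor is pulled
    back from [X x U] along [g x id], hence supported on [Q]. *)
Lemma span_class_comp (U X Y Z Z' : C) (f : mor Z Y) (g : mor Z X) (a : E Z)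
    (f' : mor Z' X) (g' : mor Z' U) (a' : E Z')
    (Q : C) (s : mor Q Z) (t : mor Q Z') :
  is_pullback s t g f' ->
  span_class f g a \o span_class f' g' a' =
  span_class (f \o s) (g' \o t) (pull E s a * pull E t a').
Proof.
case=> gs_ft univQ.
pose k : mor (Z ** U) (Y ** X ** U) := prodm P (pair P f g) (idm U).
have pbZ : is_pullback k (pr1 P Z U) (pr12 P Y X U) (pair P f g).
  split; first by rewrite /k /pr12 /prodm ?simp_prod.
  move=> W u v; rewrite /pr12 => e.
  exists (pair P v (pr2 P _ _ \o u)); split.
    split; last by rewrite ?simp_prod.
    by apply: prod_ext; rewrite /k /prodm ?simp_prod // e ?simp_prod.
  by move=> m [<- <-]; apply: prod_ext; rewrite /k /prodm ?simp_prod.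
pose j : mor Q (Z ** U) := pair P s (g' \o t).
have pbQ : is_pullback j t (prodm P g (idm U)) (pair P f' g').
  split; first by rewrite /j /prodm ?simp_prod gs_ft.
  move=> W u v /prod_eqP; rewrite /prodm ?simp_prod => -[e1 e2].
  have [m [[sm tm] uniq_m]] := univQ W (pr1 P _ _ \o u) v e1.
  exists m; split.
    split=> //; apply: prod_ext; rewrite /j ?simp_prod //.
    by rewrite tm e2.
  by move=> m' [jm' tm']; apply: uniq_m; rewrite -jm' /j ?simp_prod.
rewrite /= /corr_comp /span_class -(gysin_base_change pbZ).
rewrite -projection_formula -pushM -pullM.
have -> : pr23 P Y X U \o k = prodm P g (idm U).
  by apply: prod_ext; rewrite /pr23 /k /prodm ?simp_prod.
rewrite -(gysin_base_change pbQ) mulrC -projection_formula -pushM -pullM.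
have -> : pr1 P Z U \o j = s by rewrite /j ?simp_prod.
have -> : pr13 P Y X U \o k \o j = pair P (f \o s) (g' \o t).
  by apply: prod_ext; rewrite /pr13 /k /j /prodm ?simp_prod.
by rewrite mulrC.
Qed.

Lemma corr_span_class (X Y Z : C) (f : mor Z Y) (g : mor Z X) (a : E Z) :
  corrR E f \o corrD a \o corrI E g = span_class f g a.
Proof.
rewrite corrR_span_class corrD_span_class corrI_span_class.
rewrite (span_class_comp _ _ _ _ (pullback_idm _)) !compm1 !pull1 mul1r.
by rewrite (span_class_comp _ _ _ _ (pullback_idm _)) !compm1 !pull1 mulr1.
Qed.

End SpanClasses.

Theorem corollary1p3 (C : category) (P : binary_products C)
    (hC : finitary_lextensive C) (E : gysin_functor P) :
  [/\ (forall (X Y : C) (phi : @mor (corr_cat E) X Y),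
        exists (Z : C) (f : mor Z Y) (g : mor Z X) (a : E Z),
          phi = corrR E f \o corrD a \o corrI E g),
      (forall (U X Y Z Z' : C) (f : mor Z Y) (g : mor Z X) (a : E Z)
          (f' : mor Z' X) (g' : mor Z' U) (a' : E Z')
          (Q : C) (s : mor Q Z) (t : mor Q Z'),
        is_pullback s t g f' ->
        (corrR E f \o corrD a \o corrI E g) \o
          (corrR E f' \o corrD a' \o corrI E g') =
        corrR E (f \o s) \o corrD (pull E s a * pull E t a') \o
          corrI E (g' \o t)) &
      (forall (Y Z : C) (f : mor Z Y) (a : E Z),
        corrR E f \o corrD a \o corrI E f =
        corrR E (idm Y) \o corrD (push E f a) \o corrI E (idm Y))].
Proof.
split.
- move=> X Y phi; exists (prodo P Y X), (pr1 P Y X), (pr2 P Y X), phi.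
  rewrite corr_span_class /span_class.
  have -> : pair P (pr1 P Y X) (pr2 P Y X) = idm _.
    by rewrite -[RHS]pair_eta !compm1.
  by rewrite push1.
- move=> U X Y Z Z' f g a f' g' a' Q s t pb.
  by rewrite !corr_span_class; apply: span_class_comp.
- move=> Y Z f a; rewrite !corr_span_class /span_class -pushM.
  by rewrite comp_pair comp1m.
Qed.
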